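(* Let $R$ be a $*$-ring and suppose $\Gamma^*_s(R)$ splits into two subgraphs $X$ and $Y$ via a vertex $a$ such that $X\setminus\{a\}$ is a complete subgraph. Then $V(X)\cup\{0\}$ is an ideal of $R$.
   Context: A $*$-ring is a ring $R$ with an involution $x\mapsto x^*$. For $S\subseteq R$, $r_R(S)=\{x\in R: sx=0\ \forall s\in S\}$. The strong zero-divisor graph $\Gamma^*_s(R)$ is the simple undirected graph with vertex set $\{0\neq a\in R: r_R(aR)\neq\{0\}\}$, in which distinct vertices $a,b$ are adjacent iff $aRb^*=0$. A graph $G$ splits into subgraphs $X$ and $Y$ via $a$ if (i) $|V(X)|\ge 2$ and $|V(Y)|\ge 2$, (ii) $X\cup Y=G$, (iii) $V(X)\cap V(Y)=\{a\}$, (iv) $a$ is a cut vertex of $G$, and (v) no $x\in V(X)\setminus\{a\}$ is adjacent to any $y\in V(Y)\setminus\{a\}$. $X\setminus\{a\}$ denotes the subgraph of $X$ obtained by deleting $a$.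
   Formalization: The complete subgraph X∖{a} is required to have at least two vertices; if a single vertex counts as complete the claim fails, e.g. for Z/2×Z/3 with the identity involution, split via (1,0). *)

(* Defs.v *)
From Stdlib Require Import Relation_Operators.
From mathcomp Require Import all_boot all_algebra.
From mathcomp Require Import classical_sets.

Set Implicit Arguments.
Unset Strict Implicit.
Unset Printing Implicit Defensive.

Import GRing.Theory.
Local Open Scope ring_scope.
Local Open Scope classical_set_scope.

(* An associative ring, not assumed to have a unity, with an involution; the
   library's ring structures all include a unity, hence the separate record. *)
Record starRing := StarRing {
  star_sort :> zmodType;
  smul : star_sort -> star_sort -> star_sort;
  smulA : associative smul;
  smulDl : left_distributive smul +%R;
  smulDr : right_distributive smul +%R;
  star : star_sort -> star_sort;
  starD : {morph star : x y / x + y};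
  starM : forall x y, star (smul x y) = smul (star y) (star x);
  starK : involutive star
}.

Definition starRing_of_pzRing (R : pzRingType) (s : R -> R)
    (sD : {morph s : x y / x + y}) (sM : forall x y, s (x * y) = s y * s x)
    (sK : involutive s) : starRing :=
  @StarRing R *%R (@mulrA R) (@mulrDl R) (@mulrDr R) s sD sM sK.

Local Notation "x ∙ y" := (smul x y) (at level 40, left associativity).

Section StarRing.
Variable R : starRing.

Lemma star0 : star (0 : R) = 0.
Proof. by apply: (@addrI _ (star (0 : R))); rewrite -starD !addr0. Qed.

Definition rann (S : set R) : set R := [set x | forall s, S s -> s ∙ x = 0].

Definition rmulset (a : R) : set R := [set a ∙ r | r in [set: R]].

Record is_ideal (I : set R) : Prop := IsIdeal {
  ideal0 : I 0;
  idealB : forall x y, I x -> I y -> I (x - y);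
  idealMl : forall r x, I x -> I (r ∙ x);
  idealMr : forall r x, I x -> I (x ∙ r)
}.

End StarRing.

Record sgraph (T : Type) := SGraph {
  vert : set T;
  adj : T -> T -> Prop;
  adj_sym : forall x y, adj x y -> adj y x;
  adj_irrefl : forall x, ~ adj x x;
  adj_vert : forall x y, adj x y -> vert x /\ vert y
}.

Section Graphs.
Variable T : Type.
Implicit Types (G H X Y : sgraph T) (a : T).

Definition subgraph H G : Prop :=
  vert H `<=` vert G /\ forall x y, adj H x y -> adj G x y.

Definition del_vertex G a : sgraph T.
Proof.
refine (@SGraph T (vert G `\ a)
         (fun x y => [/\ adj G x y, x <> a & y <> a]) _ _ _).
- by move=> x y [xy xa ya]; split=> //; apply: adj_sym.
- by move=> x [xx _ _]; apply: adj_irrefl xx.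
- by move=> x y [xy xa ya]; have [Vx Vy] := adj_vert xy.
Defined.

(* A one-vertex graph is not counted as complete: two distinct vertices are
   required. If K_1 were allowed, the theorem would fail, e.g. for Z/2 x Z/3
   with the identity involution: the graph is the path
   (0,1) -- (1,0) -- (0,2), which splits via (1,0) with
   V(X) = {(1,0), (0,1)}, and V(X) together with 0 is not an ideal. *)
Definition complete_graph G : Prop :=
  (exists x y, [/\ vert G x, vert G y & x <> y]) /\
  (forall x y, vert G x -> vert G y -> x <> y -> adj G x y).

Definition joined G (u v : T) : Prop :=
  [/\ vert G u, vert G v & clos_refl_trans T (adj G) u v].

(* Deleting a disconnects two remaining vertices of one component of G, i.e.
   it increases the number of connected components; G may be disconnected. *)
Definition cut_vertex G a : Prop :=
  vert G a /\
  exists u v, [/\ u <> a, v <> a, joined G u v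
                & ~ joined (del_vertex G a) u v].

Record splits_via G X Y a : Prop := SplitsVia {
  splits_subl : subgraph X G;
  splits_subr : subgraph Y G;
  splits_card_l : exists x y, [/\ vert X x, vert X y & x <> y];
  splits_card_r : exists x y, [/\ vert Y x, vert Y y & x <> y];
  splits_vertU : vert X `|` vert Y = vert G;
  splits_adjU : forall x y, adj G x y <-> adj X x y \/ adj Y x y;
  splits_vertI : vert X `&` vert Y = [set a];
  splits_cut : cut_vertex G a;
  splits_nadj : forall x y, vert X x -> x <> a -> vert Y y -> y <> a ->
                  ~ adj G x y
}.

End Graphs.

Section StrongZeroDivisorGraph.
Variable R : starRing.

Definition szd_vert : set R :=
  [set a | a <> 0 /\ rann (rmulset a) <> [set 0]].

Definition szd_adj (a b : R) : Prop :=
  [/\ szd_vert a, szd_vert b, a <> b & forall r : R, a ∙ r ∙ star b = 0].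

Definition szd_graph : sgraph R.
Proof.
refine (@SGraph R szd_vert szd_adj _ _ _).
- move=> a b [Va Vb ab arb]; split=> // [/esym //|r].
  have := congr1 (@star R) (arb (star r)).
  by rewrite !starM !starK star0 smulA.
- by move=> a [].
- by move=> a b [].
Defined.

End StrongZeroDivisorGraph.

(* Main.v *)
Require Import Defs.
From Stdlib Require Import Relation_Operators.
From mathcomp Require Import all_boot all_algebra.
From mathcomp Require Import boolp classical_sets.

Set Implicit Arguments.
Unset Strict Implicit.
Unset Printing Implicit Defensive.

Import GRing.Theory.
Local Open Scope ring_scope.
Local Open Scope classical_set_scope.

(** Write [x ⊥ y] for [x R y^* = 0]; this relation is symmetric and
    [{y | x ⊥ y}] is a two-sided ideal for every [x]. The splitting provides
    neighbours [x0] of [a] in [X] and [y0] of [a] in [Y], and the ideal of the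
    elements orthogonal to both [x0] and [y0] is [{0, a}], so that [a + a = 0].
    If [x0 ⊥ x0], then [V(X) ∪ {0}] is the ideal of the elements orthogonal to
    [x0]. Otherwise let [x1] be a third vertex of [X]. Then [x1 + a] is a vertex
    of [X], distinct from [x1] and [a], hence [x1 ⊥ x1 + a]; so [x0 + x1 + a] is
    orthogonal to [x1] and therefore belongs to [X]. By completeness it is
    orthogonal to [x0], which forces [x0 ⊥ x0].

    The graph need not be connected, so the existence of [x0] needs an argument.
    If [a] has no neighbour in [X], then the annihilating ideals of a vertex of
    [X \ a] and of a vertex of [Y] meet in [0]; their products vanish, and this
    makes any two non-isolated vertices of [Y] orthogonal, against [a] being a
    cut vertex. *)

Local Notation "x ∙ y" := (smul x y) (at level 40, left associativity).

(** * Walks in a graph and the effect of deleting a vertex *)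

Section Joined.
Variables (T : Type) (G : sgraph T).

Lemma joined_sym u v : joined G u v -> joined G v u.
Proof.
move=> [Vu Vv uv]; split=> //; elim: uv {Vu Vv}.
- by move=> x y xy; apply: rt_step; apply: adj_sym.
- by move=> x; apply: rt_refl.
- by move=> x y z _ yx _ zy; apply: rt_trans zy yx.
Qed.

Lemma joined_refl u : vert G u -> joined G u u.
Proof. by move=> Vu; split=> //; apply: rt_refl. Qed.

Lemma joined_adj u v : adj G u v -> joined G u v.
Proof. by move=> uv; have [Vu Vv] := adj_vert uv; split=> //; apply: rt_step. Qed.

Lemma joined_neighbour u v : joined G u v -> u <> v -> exists w, adj G u w.
Proof.
move=> [_ _ uv]; elim: uv => [x y xy _|x|x y z _ IHxy _ IHyz xz].
- by exists y.
- by [].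
- have [exy|/IHxy //] := pselect (x = y).
  by rewrite exy in xz *; apply: IHyz.
Qed.

(** A walk that starts in [C] can never leave it, so it avoids [a] and survives the deletion. This
    is how [a] being a cut vertex gets contradicted. *)
Lemma joined_del_closed (a : T) (C : set T) u v :
    (forall x y, C x -> adj G x y -> C y) -> ~ C a -> C u ->
  joined G u v -> joined (del_vertex G a) u v.
Proof.
move=> Cadj Ca Cu [Vu Vv uv].
have Cneq x : C x -> x <> a by move=> Cx xa; apply: Ca; rewrite -xa.
have : C v /\ clos_refl_trans T (adj (del_vertex G a)) u v.
  elim: uv Cu {Vu Vv} => [x y xy Cx|x Cx|x y z _ IHxy _ IHyz Cx].
  - have Cy := Cadj _ _ Cx xy; split=> //.
    by apply: rt_step; split=> //; apply: Cneq.
  - by split=> //; apply: rt_refl.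
  - have [Cy xy] := IHxy Cx; have [Cz yz] := IHyz Cy.
    by split=> //; apply: rt_trans xy yz.
by move=> [Cv uv']; split=> //; split=> //; apply: Cneq.
Qed.

End Joined.

(** * The orthogonality relation and its ideals *)

Section Perp.
Variable R : starRing.
Implicit Types x y z b r : R.

Definition perp x y : Prop := forall r, x ∙ r ∙ star y = 0.

Lemma smul0 x : x ∙ 0 = 0.
Proof. by apply: (@addrI _ (x ∙ 0)); rewrite -smulDr !addr0. Qed.

Lemma mul0s x : 0 ∙ x = 0.
Proof. by apply: (@addrI _ (0 ∙ x)); rewrite -smulDl !addr0. Qed.

Lemma starN x : star (- x) = - star x.
Proof. by apply: (@addrI _ (star x)); rewrite -starD !addrN star0. Qed.

Lemma smulN x y : x ∙ (- y) = - (x ∙ y).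
Proof. by apply: (@addrI _ (x ∙ y)); rewrite -smulDr !addrN smul0. Qed.

Lemma star_neq0 x : x <> 0 -> star x <> 0.
Proof. by move=> x0 sx; apply: x0; rewrite -(starK x) sx star0. Qed.

Lemma perp_sym x y : perp x y -> perp y x.
Proof.
move=> xy r; have := congr1 (@star R) (xy (star r)).
by rewrite !starM !starK star0 smulA.
Qed.

Lemma perp_ideal b : is_ideal (perp b).
Proof.
split.
- by move=> r; rewrite star0 smul0.
- by move=> x y bx by_ r; rewrite starD starN smulDr smulN bx by_ subr0.
- by move=> s x bx r; rewrite starM smulA bx mul0s.
- by move=> s x bx r; rewrite starM smulA -(smulA b r) bx.
Qed.

Lemma perpN b x : perp b x -> perp b (- x).
Proof.
have I := perp_ideal b => bx; rewrite -sub0r.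
exact: (idealB I (ideal0 I) bx).
Qed.

Lemma perpD b x y : perp b x -> perp b y -> perp b (x + y).
Proof.
move=> bx /perpN bNy; rewrite -(opprK y).
exact: (idealB (perp_ideal b)).
Qed.

(** The nonzero element [star y] lies in the right annihilator of [rmulset x]. *)
Lemma perp_vert x y : x <> 0 -> y <> 0 -> perp x y -> szd_vert x.
Proof.
move=> x0 y0 xy; split=> // e.
suff : [set 0] (star y) by apply: star_neq0.
by rewrite -e => _ [r _ <-]; apply: xy.
Qed.

Lemma perp_adj x y : x <> 0 -> y <> 0 -> x <> y -> perp x y -> adj (szd_graph R) x y.
Proof.
move=> x0 y0 nxy xy; split=> //; first exact: (perp_vert x0 y0).
exact/(perp_vert y0 x0)/perp_sym.
Qed.

Lemma adj_perp x y : adj (szd_graph R) x y -> perp x y.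
Proof. by case. Qed.

End Perp.

(** * Orthogonality in a graph split at [a] *)

Section Split.
Variables (R : starRing) (X Y : sgraph R) (a : R).
Hypothesis XYa : splits_via (szd_graph R) X Y a.
Hypothesis cX : complete_graph (del_vertex X a).

Local Notation G := (szd_graph R).
Local Notation X' := (vert X `\ a).
Local Notation Y' := (vert Y `\ a).

Lemma split_vertX x : vert X x -> vert G x.
Proof. by apply: (splits_subl XYa).1. Qed.

Lemma split_neq0 x : vert X x -> x <> 0.
Proof. by move=> /split_vertX []. Qed.

Lemma split_neq0Y y : vert Y y -> y <> 0.
Proof. by move=> /(splits_subr XYa).1 []. Qed.

Lemma split_cases x : vert G x -> [\/ x = a, X' x | Y' x].
Proof.
move=> Vx; have [->|xa] := pselect (x = a); first by constructor 1.
by move: Vx; rewrite -(splits_vertU XYa) => -[Vx|Vx];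
  [constructor 2 | constructor 3].
Qed.

Lemma split_a : vert X a /\ vert Y a.
Proof.
by have : (vert X `&` vert Y) a by rewrite (splits_vertI XYa).
Qed.

Lemma split_disjoint x : X' x -> ~ vert Y x.
Proof.
move=> [Xx xa] Yx; apply: xa.
by have : (vert X `&` vert Y) x by []; rewrite (splits_vertI XYa).
Qed.

Lemma split_adjX x y : X' x -> adj G x y -> vert X y.
Proof.
move=> [Xx xa] xy; have [_ Vy] := adj_vert xy.
have [->|[]//|[Yy ya]] := split_cases Vy; first exact: split_a.1.
by case: (splits_nadj XYa Xx xa Yy ya).
Qed.

Lemma split_adjY x y : Y' x -> adj G x y -> vert Y y.
Proof.
move=> [Yx xa] xy; have [_ Vy] := adj_vert xy.
have [->|[Xy ya]|[]//] := split_cases Vy; first exact: split_a.2.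
by case: (splits_nadj XYa Xy ya Yx xa); apply: adj_sym.
Qed.

Lemma split_perpX x y : X' x -> y <> 0 -> perp x y -> vert X y.
Proof.
move=> X'x y0 xy; have [Xx _] := X'x.
have [<- //|nxy] := pselect (x = y).
by apply: (split_adjX X'x); apply: perp_adj => //; apply: split_neq0.
Qed.

Lemma split_complete_adj x y : X' x -> X' y -> x <> y -> adj (del_vertex G a) x y.
Proof.
move=> X'x X'y nxy; have [xy _ _] := cX.2 _ _ X'x X'y nxy.
by split; [apply: (splits_subl XYa).2 | case: X'x | case: X'y].
Qed.

Lemma split_complete x y : X' x -> X' y -> x <> y -> perp x y.
Proof.
by move=> X'x X'y /(split_complete_adj X'x X'y)[xy _ _]; apply: adj_perp.
Qed.

Lemma split_other x : exists2 z, X' z & z <> x.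
Proof.
have [[u [v [X'u X'v uv]]] _] := cX.
by have [ux|ux] := pselect (u = x); [exists v => // vx; apply: uv; rewrite vx | exists u].
Qed.

(** Otherwise [Y'] is closed under adjacency, so walks from [Y'] avoid [a]. Since distinct vertices
    of [X'] are adjacent, deleting [a] would disconnect nothing. *)
Lemma split_neighbourY : exists2 y, Y' y & perp y a.
Proof.
apply: contrapT => noY.
have Yclosed x y : Y' x -> adj G x y -> Y' y.
  move=> Y'x xy; split; first exact: split_adjY xy.
  by move=> ya; apply: noY; exists x => //; rewrite -ya; apply: adj_perp.
have nY'a : ~ Y' a by move=> [_]; apply.
have [_ [u [v [ua va uv nuv_del]]]] := splits_cut XYa; apply: nuv_del.
have [Vu Vv _] := uv.
have [//|X'u|Y'u] := split_cases Vu; last exact: (joined_del_closed Yclosed).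
have [//|X'v|Y'v] := split_cases Vv; last first.
  by apply/joined_sym/(joined_del_closed Yclosed) => //; apply: joined_sym.
have [<-|nuv] := pselect (u = v); first exact: joined_refl.
exact/joined_adj/split_complete_adj.
Qed.

Lemma split_neighbourX : exists2 x, X' x & perp x a.
Proof.
apply: contrapT => noX.
have nXa x : X' x -> ~ perp x a by move=> X'x xa; apply: noX; exists x.
have Xclosed x y : X' x -> adj G x y -> X' y.
  move=> X'x xy; split; first exact: split_adjX xy.
  by move=> ya; apply: (nXa x) => //; rewrite -ya; apply: adj_perp.
have perpX x z : X' x -> z <> 0 -> perp x z -> X' z.
  move=> X'x z0 xz; split; first exact: split_perpX xz.
  by move=> za; apply: (nXa x) => //; rewrite -za.
(* A nonzero [z] would lie in [X'] and be adjacent to [y], although [X'] is closed under adjacency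
   and disjoint from [Y]. *)
have disj x y z : X' x -> vert Y y -> perp x z -> perp y z -> z = 0.
  move=> X'x Yy xz yz; apply: contrapT => z0.
  have X'z := perpX _ _ X'x z0 xz.
  have zy : adj G z y.
    apply: perp_adj => //; [exact: split_neq0Y | | exact: perp_sym].
    by move=> zy; apply: (split_disjoint X'z); rewrite zy.
  by have X'y := Xclosed _ _ X'z zy; apply: (split_disjoint X'y).
(* For another [z] in [X'], both products lie in the ideal [perp z] because of [x] and in [perp y]
   because of [w]; [disj] applies. *)
have mul0 x y w r : X' x -> vert Y y -> perp y w -> x ∙ r ∙ w = 0 /\ w ∙ r ∙ x = 0.
  move=> X'x Yy yw; have [z X'z zx] := split_other x.
  have zx' := split_complete X'z X'x zx.
  have Iz := perp_ideal z; have Iy := perp_ideal y.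
  split; apply: (disj z y) => //.
  - exact: (Defs.idealMr Iz _ (Defs.idealMr Iz _ zx')).
  - exact: (idealMl Iy).
  - exact: (idealMl Iz).
  - exact: (Defs.idealMr Iy _ (Defs.idealMr Iy _ yw)).
have [x0 X'x0 _] := split_other a.
have starX y w : vert Y y -> w <> 0 -> perp y w -> X' (star w).
  move=> Yy w0 yw; apply: (perpX x0) => //; first exact: star_neq0.
  by move=> r; rewrite starK; case: (mul0 x0 y w r X'x0 Yy yw).
have nX'a : ~ X' a by move=> [_]; apply.
have [_ [u [v [ua va uv nuv_del]]]] := splits_cut XYa; apply: nuv_del.
have [Vu Vv _] := uv.
have [//|X'u|Y'u] := split_cases Vu; first exact: (joined_del_closed Xclosed).
have [//|X'v|Y'v] := split_cases Vv.
  by apply/joined_sym/(joined_del_closed Xclosed) => //; apply: joined_sym.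
have [<-|nuv] := pselect (u = v); first exact: joined_refl.
(* Both [u] and [v] are now in [Y']. A neighbour of [v] puts [star v] in [X'], and a neighbour of
   [u] lets [mul0] kill [u ∙ r ∙ star v]; hence [u] and [v] are adjacent. *)
have [u1 uu1] := joined_neighbour uv nuv.
have [v1 vv1] := joined_neighbour (joined_sym uv) (nesym nuv).
have X'sv : X' (star v).
  apply: (starX v1); [exact: split_adjY vv1 | by case: Vv |].
  exact/perp_sym/adj_perp.
have uv_perp : perp u v.
  move=> r; have Yu1 := split_adjY Y'u uu1.
  by case: (mul0 _ _ u r X'sv Yu1 (perp_sym (adj_perp uu1))).
have [u0 _] := Vu; have [v0 _] := Vv.
by apply: joined_adj; split=> //; apply: perp_adj.
Qed.

(** If nonzero, [a + a] would be a vertex of [X] other than [a], being orthogonal to [x0], and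
    adjacent to a vertex of [Y'] that is orthogonal to [a]. *)
Lemma split_double x0 : X' x0 -> perp x0 a -> a + a = 0.
Proof.
move=> X'x0 x0a; have [y0 Y'y0 y0a] := split_neighbourY.
have a0 := split_neq0 split_a.1.
apply: contrapT => aa0.
have Xaa : vert X (a + a) by apply: split_perpX (perpD x0a x0a).
have aa_neq : a + a <> a by move=> /eqP; rewrite -subr_eq0 addrK => /eqP.
have y0_neq : a + a <> y0.
  by move=> e; apply: (@split_disjoint (a + a)); rewrite ?e; [rewrite -e|case: Y'y0].
have [Yy0 y0_a] := Y'y0.
apply: (splits_nadj XYa Xaa aa_neq Yy0 y0_a).
apply: perp_adj => //; [exact: split_neq0Y | exact/perp_sym/perpD].
Qed.

Lemma split_neighbour_self_perp x0 : X' x0 -> perp x0 a -> perp x0 x0.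
Proof.
move=> X'x0 x0a; apply: contrapT => nx0.
have aa := split_double X'x0 x0a.
have a0 := split_neq0 split_a.1.
have [x1 X'x1 x1x0] := split_other x0.
have x0x1 := split_complete X'x0 X'x1 (nesym x1x0).
have x0x1a := perpD x0x1 x0a.
(* Characteristic two on [a] enters here: [x1 = - a] would mean [x1 = a]. *)
have x1a0 : x1 + a <> 0.
  by move=> e; case: X'x1 => _; apply; apply: (addIr a); rewrite e aa.
have X'x1a : X' (x1 + a).
  split; first exact: split_perpX x0x1a.
  move=> /= /eqP; rewrite -subr_eq0 addrK => /eqP.
  by apply: split_neq0; case: X'x1.
have x1x1a : perp x1 (x1 + a).
  apply: split_complete => // /eqP.
  by rewrite eq_sym -subr_eq0 addrC addKr => /eqP.
set t := x0 + (x1 + a).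
have x1t : perp x1 t by apply: perpD => //; apply: perp_sym.
(* Each of [t = 0] and [t = a] would write [x0] as the opposite of an element orthogonal to [x0]. *)
have t0 : t <> 0.
  move=> /eqP; rewrite addr_eq0 => /eqP e.
  by apply: nx0; rewrite {2}e; apply: perpN.
have Xt := split_perpX X'x1 t0 x1t.
have ta : t <> a.
  rewrite /t addrA => /eqP; rewrite -subr_eq0 addrK addr_eq0 => /eqP e.
  by apply: nx0; rewrite {2}e; apply: perpN.
have tx0 : x0 <> t.
  by move=> /eqP; rewrite eq_sym -subr_eq0 /t addrC addKr => /eqP.
have X't : X' t by [].
have x0t : perp x0 t by apply: split_complete.
by apply: nx0; rewrite -{2}(addrK (x1 + a) x0); apply: perpD => //; apply: perpN.
Qed.

End Split.

Theorem theorem2p8 (R : starRing) (X Y : sgraph R) (a : R) :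
  splits_via (szd_graph R) X Y a ->
  complete_graph (del_vertex X a) ->
  is_ideal (vert X `|` [set 0]).
Proof.
move=> XYa cX; have [x0 X'x0 x0a] := split_neighbourX XYa cX.
have x0x0 := split_neighbour_self_perp XYa cX X'x0 x0a.
(* Completeness makes [x0] orthogonal to the rest of [X']; [x0a] and [x0x0] cover [a] and [x0]
   itself. *)
suff -> : vert X `|` [set 0] = perp x0 by apply: perp_ideal.
apply/seteqP; split=> [x [Xx|->]|x x0x]; last 1 first.
- have [->|nx] := pselect (x = 0); first by right.
  by left; apply: (split_perpX XYa X'x0).
- have [->//|xa] := pselect (x = a).
  have [<-//|nx] := pselect (x0 = x).
  exact: (split_complete XYa cX).
- exact: ideal0 (perp_ideal x0).
Qed.
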